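(* Let $s$ be an integer-valued statistic on a class of combinatorial objects (no symmetry assumed), let $S(m,n)$ be the number of objects of weight $n$ with statistic $m$, and let $G_S(\zeta;q)=\sum_{n\ge 0,\,m\in\mathbb{Z}}S(m,n)\zeta^m q^n$ with $\zeta=e^{2\pi i z}$, $q=e^{2\pi i\tau}$. Define functions $g_n(\tau)$, $n\ge1$, by $$G_S(\zeta;q)=G_S(1;q)\exp\left(\sum_{n\ge1}g_n(\tau)\frac{(2\pi i z)^n}{n!}\right),$$ and let $\mathcal{M}_r(q)=\frac{1}{G_S(1;q)}\sum_{n\ge0}\sum_{m\in\mathbb{Z}}m^rS(m,n)q^n$. Then for every $r\ge1$, $$\mathcal{M}_r(q)=B_r(g_1,g_2,\ldots,g_r)=\sum_{\lambda\vdash r}\phi_B(\lambda)\,g_\lambda,$$ and conversely, for every $k\ge1$, $$g_k(\tau)=\sum_{\lambda\vdash k}\mu(\lambda)\,\phi_B(\lambda)\,\mathcal{M}_\lambda.$$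
   Context: The number of objects of each weight is finite, and $G_S(1;q)$ is not zero. The expansion defining $g_n$ is an identity of power series in $z$ whose coefficients are functions of $\tau$ ($q$-series), where $\zeta^m=e^{2\pi i m z}$ is expanded in powers of $z$. The complete Bell polynomials $B_n(X_1,\ldots,X_n)$ are defined by $\sum_{n\ge0}B_n(X_1,\ldots,X_n)\frac{t^n}{n!}=\exp\left(\sum_{j\ge1}X_j\frac{t^j}{j!}\right)$. A partition $\lambda\vdash n$ is written $\lambda=(1^{m_1},\ldots,n^{m_n})$, with $m_j\ge0$ the multiplicity of the part $j$ and $\sum_j jm_j=n$; $\ell(\lambda)=m_1+\cdots+m_n$. For a sequence $\{X_j\}_{j\ge1}$, $X_\lambda=\prod_{j}X_j^{m_j}$ (so $g_\lambda=\prod_j g_j^{m_j}$ and $\mathcal{M}_\lambda=\prod_j\mathcal{M}_j(q)^{m_j}$). For $\lambda\vdash n$, $$\phi_B(\lambda)=n!\prod_{j=1}^n\frac{1}{m_j!\,(j!)^{m_j}},\qquad \mu(\lambda)=(-1)^{\ell(\lambda)-1}(\ell(\lambda)-1)!.$$ *)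

(* Defs.v *)
From HB Require Import structures.
From mathcomp Require Import all_boot all_order all_algebra.
From mathcomp Require Import finmap complex.
From mathcomp Require Import boolp classical_sets functions cardinality fsbigop.
From mathcomp Require Import reals trigo.

Set Implicit Arguments.
Unset Strict Implicit.
Unset Printing Implicit Defensive.

Import GRing.Theory.

Local Open Scope classical_set_scope.
Local Open Scope ring_scope.
Local Open Scope complex_scope.

(* Formal power series in one variable with coefficients in A. *)
Record fps (A : Type) := FPS { fps_coef : nat -> A }.

Lemma fpsP (A : Type) (f g : fps A) : fps_coef f =1 fps_coef g -> f = g.
Proof. by case: f g => [f] [g] /= /funext ->. Qed.

HB.instance Definition _ (A : Type) := gen_eqMixin (fps A).
HB.instance Definition _ (A : Type) := gen_choiceMixin (fps A).

Section FpsZmodule.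
Variable A : zmodType.
Implicit Types f g : fps A.

Definition fps_zero : fps A := FPS (fun=> 0).
Definition fps_opp f : fps A := FPS (fun n => - fps_coef f n).
Definition fps_add f g : fps A := FPS (fun n => fps_coef f n + fps_coef g n).

Lemma fps_addA : associative fps_add.
Proof. by move=> f g h; apply: fpsP => n /=; rewrite addrA. Qed.
Lemma fps_addC : commutative fps_add.
Proof. by move=> f g; apply: fpsP => n /=; rewrite addrC. Qed.
Lemma fps_add0 : left_id fps_zero fps_add.
Proof. by move=> f; apply: fpsP => n /=; rewrite add0r. Qed.
Lemma fps_addN : left_inverse fps_zero fps_opp fps_add.
Proof. by move=> f; apply: fpsP => n /=; rewrite addNr. Qed.

HB.instance Definition _ :=
  GRing.isZmodule.Build (fps A) fps_addA fps_addC fps_add0 fps_addN.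
End FpsZmodule.

Section FpsRing.
Variable A : comNzRingType.
Implicit Types f g h : fps A.

Definition fpsC (a : A) : fps A := FPS (fun n => if n == 0%N then a else 0).
Definition fpsX : fps A := FPS (fun n => (n == 1%N)%:R).

Definition fps_mul f g : fps A :=
  FPS (fun n => \sum_(i < n.+1) fps_coef f i * fps_coef g (n - i)).

Lemma fps_mul_poly f g n k : (k < n)%N ->
  fps_coef (fps_mul f g) k =
  (\poly_(i < n) fps_coef f i * \poly_(i < n) fps_coef g i)`_k.
Proof.
move=> kn; rewrite coefM; apply: eq_bigr => i _; rewrite !coef_poly.
by rewrite (leq_ltn_trans (leq_ord i) kn) (leq_ltn_trans (leq_subr i k) kn).
Qed.

Lemma fps_mulC : commutative fps_mul.
Proof.
by move=> f g; apply: fpsP => n; rewrite !(@fps_mul_poly _ _ n.+1)// mulrC.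
Qed.

Lemma fps_mul3_poly f g h n : fps_coef (fps_mul (fps_mul f g) h) n =
  (\poly_(i < n.+1) fps_coef f i * \poly_(i < n.+1) fps_coef g i
     * \poly_(i < n.+1) fps_coef h i)`_n.
Proof.
rewrite coefM; apply: eq_bigr => i _; rewrite (@fps_mul_poly _ _ n.+1)//.
by rewrite [X in _ = _ * X]coef_poly ltnS leq_subr.
Qed.

Lemma fps_mulA : associative fps_mul.
Proof.
move=> f g h; apply: fpsP => n.
by rewrite fps_mulC !fps_mul3_poly mulrC mulrA.
Qed.

Lemma fps_mul1 : left_id (fpsC 1) fps_mul.
Proof.
move=> f; apply: fpsP => n /=.
by rewrite big_ord_recl/= mul1r subn0 big1 ?addr0// => i _; rewrite mul0r.
Qed.

Lemma fps_mulDl : left_distributive fps_mul (@fps_add A).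
Proof.
move=> f g h; apply: fpsP => n /=.
by rewrite -big_split/=; apply: eq_bigr => i _; rewrite mulrDl.
Qed.

Lemma fps_one_neq0 : fpsC 1 != 0 :> fps A.
Proof.
apply/eqP => /(congr1 (fun f => fps_coef f 0%N)) /= /eqP.
by rewrite oner_eq0.
Qed.

HB.instance Definition _ := GRing.Zmodule_isComNzRing.Build (fps A)
  fps_mulA fps_mulC fps_mul1 fps_mulDl fps_one_neq0.

Definition fps_unit : {pred fps A} := [pred f | `[< exists g, g * f = 1 >]].

Definition fps_inv f : fps A :=
  if pselect (exists g, g * f = 1) is left fu then sval (cid fu) else f.

Lemma fps_mulV : {in fps_unit, left_inverse 1 fps_inv *%R}.
Proof.
move=> f /asboolP fu; rewrite /fps_inv.
by case: pselect => // fu'; exact: (svalP (cid fu')).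
Qed.

Lemma fps_unitPl f g : g * f = 1 -> fps_unit f.
Proof. by move=> gf; apply/asboolP; exists g. Qed.

Lemma fps_inv_out : {in [predC fps_unit], fps_inv =1 id}.
Proof.
move=> f /asboolPn nfu; rewrite /fps_inv.
by case: pselect.
Qed.

HB.instance Definition _ := GRing.ComNzRing_hasMulInverse.Build (fps A)
  fps_mulV fps_unitPl fps_inv_out.
End FpsRing.

Section FpsIntegral.
Variable A : idomainType.

Lemma fps_neq0_lead (f : fps A) : f != 0 ->
  exists2 i, fps_coef f i != 0 & forall j, (j < i)%N -> fps_coef f j = 0.
Proof.
move=> f0; have ex : exists i, fps_coef f i != 0.
  apply: contrapT => nex; move/eqP: f0; apply; apply: fpsP => i /=.
  by apply/eqP; apply: contrapT => /negP fi; apply: nex; exists i.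
case: (ex_minnP ex) => i fi min_i; exists i => // j ji.
by apply/eqP; apply: contraTT ji => /min_i; rewrite -leqNgt.
Qed.

Lemma fps_integral : GRing.integral_domain_axiom (fps A).
Proof.
move=> f g fg0; apply: contrapT => /negP; rewrite negb_or.
move=> /andP[/fps_neq0_lead[i fi fmin] /fps_neq0_lead[j gj gmin]].
have := congr1 (fun h => fps_coef h (i + j)%N) fg0.
rewrite /= (bigD1 (inord i)) //= inordK ?ltnS ?leq_addr// addKn big1.
  by move=> /eqP; rewrite addr0 mulf_eq0 (negPf fi) (negPf gj).
move=> k; rewrite -val_eqE /= inordK ?ltnS ?leq_addr// neq_ltn => /orP[ki|ik].
  by rewrite fmin ?mul0r.
by rewrite [X in _ * X]gmin ?mulr0// ltn_subLR ?leq_ord// ltn_add2r.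
Qed.

HB.instance Definition _ := GRing.ComUnitRing_isIntegral.Build (fps A)
  fps_integral.
End FpsIntegral.

Definition fps_map (A B : Type) (h : A -> B) (f : fps A) : fps B :=
  FPS (fun n => h (fps_coef f n)).

(* A[[x]][[y]] -> A[[y]][[x]] *)
Definition fps_swap (A : Type) (f : fps (fps A)) : fps (fps A) :=
  FPS (fun r => FPS (fun n => fps_coef (fps_coef f n) r)).

Section Exponential.
Variable F : fieldType.

(* Meaningful when [f] (resp. [w]) has zero constant term: then the k-th power
   has no coefficient below degree k, so the omitted terms k > n vanish. *)
Definition fps_exp (f : fps F) : fps F :=
  FPS (fun n => \sum_(0 <= k < n.+1) fps_coef (f ^+ k) n / k`!%:R).

(* \sum_(j >= 1) X_j w^j / j! *)
Definition egf (X : nat -> F) (w : fps F) : fps F :=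
  FPS (fun n => \sum_(1 <= j < n.+1) X j * fps_coef (w ^+ j) n / j`!%:R).

(* B_n(X_1, ..., X_n); the value X 0 is never used. *)
Definition bell (n : nat) (X : nat -> F) : F :=
  n`!%:R * fps_coef (fps_exp (egf X (fpsX F))) n.
End Exponential.

(* A partition (1^{m_1}, ..., n^{m_n}) of n is given by its multiplicities:
   the ordinal j : 'I_n stands for the part j.+1. A multiplicity is at most n,
   so the codomain 'I_n.+1 loses nothing. *)
Definition multiplicities (n : nat) := {ffun 'I_n -> 'I_n.+1}.

Definition is_part (n : nat) (la : multiplicities n) : bool :=
  (\sum_(j < n) j.+1 * la j == n)%N.

Definition part_length (n : nat) (la : multiplicities n) : nat :=
  (\sum_(j < n) la j)%N.

Section PartitionCoefficients.
Variables (F : fieldType) (n : nat).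

Definition part_prod (X : nat -> F) (la : multiplicities n) : F :=
  \prod_(j < n) X j.+1 ^+ la j.

Definition phiB (la : multiplicities n) : F :=
  n`!%:R * \prod_(j < n) ((la j)`!%:R * (j.+1)`!%:R ^+ la j)^-1.

Definition mu (la : multiplicities n) : F :=
  (-1) ^+ (part_length la).-1 * ((part_length la).-1)`!%:R.
End PartitionCoefficients.

Section GeneratingFunction.
Variables (T : choiceType) (wt : T -> nat) (s : T -> int).

Definition nb_objects (m : int) (n : nat) : nat :=
  #|` fset_set [set x | wt x = n /\ s x = m] |%fset.

(* G_S(zeta; q) as a series in q, for zeta invertible in A *)
Definition GS (A : comUnitRingType) (zeta : A) : fps A :=
  FPS (fun n => \sum_(m \in [set: int]) (nb_objects m n)%:R * zeta ^ m).

Variable R : realType.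

Definition two_pi_i : R[i] := (2 * pi)*i.

(* The field C((q)), as the fraction field of C[[q]] *)
Definition qfield := {fraction (fps R[i])}.

Definition of_qseries : fps R[i] -> qfield := @FracField.tofrac (fps R[i]).

(* 2 pi i z *)
Definition two_pi_i_z : fps R[i] := fpsC two_pi_i * fpsX R[i].

(* G_S(e^{2 pi i z}; q), a priori in C[[z]][[q]], as a series in z *)
Definition GS_z : fps qfield :=
  fps_map of_qseries (fps_swap (GS (fps_exp two_pi_i_z))).

Definition GS1 : fps R[i] := GS (1 : R[i]).

(* \sum_(n >= 0) \sum_m m^r S(m, n) q^n *)
Definition power_sum_series (r : nat) : fps R[i] :=
  FPS (fun n => \sum_(m \in [set: int]) (m%:~R : R[i]) ^+ r * (nb_objects m n)%:R).

(* M_r(q) *)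
Definition moment (r : nat) : qfield :=
  (of_qseries GS1)^-1 * of_qseries (power_sum_series r).
End GeneratingFunction.

(* Main.v *)
(* Expand in powers of z: the coefficient of z^r in zeta^m is (2 pi i m)^r / r!,
   so the normalized moments have exponential generating function G_S / G_S(1),
   which is exp (sum_j g_j t^j / j!) in the variable t = 2 pi i z; comparing
   coefficients gives M_r = B_r(g). Writing exp of a finite sum as the product
   of the exponentials, with an auxiliary variable counting the number of
   parts, turns the coefficient of t^n in f^k / k! into a sum over partitions
   of n with k parts. Summed against the Taylor coefficients of exp this is
   the formula for B_n; summed against those of log (1 + h) it gives the
   inverse formula, as log (exp f) = f by differentiation. *)
Require Import Defs.
From HB Require Import structures.
From mathcomp Require Import all_boot all_order all_algebra.
From mathcomp Require Import finmap complex.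
From mathcomp Require Import boolp classical_sets functions cardinality fsbigop.
From mathcomp Require Import reals trigo.

Set Implicit Arguments.
Unset Strict Implicit.
Unset Printing Implicit Defensive.

Import GRing.Theory.

Local Open Scope classical_set_scope.
Local Open Scope ring_scope.

(** * Coefficients of sums, powers and products of power series *)

Lemma fps_coef_sum (A : zmodType) (I : Type) (r : seq I) (P : pred I)
    (f : I -> fps A) n :
  fps_coef (\sum_(i <- r | P i) f i) n = \sum_(i <- r | P i) fps_coef (f i) n.
Proof. exact: (big_morph (fun h : fps A => fps_coef h n)). Qed.

Lemma fps_coefMn (A : zmodType) (f : fps A) m n :
  fps_coef (f *+ m) n = fps_coef f n *+ m.
Proof. by elim: m => // m IHm; rewrite !mulrS -IHm. Qed.

Section Truncation.
Variable A : comNzRingType.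

Lemma fps_coefCM (a : A) (f : fps A) n :
  fps_coef (fpsC a * f) n = a * fps_coef f n.
Proof.
by rewrite /= big_ord_recl /= subn0 big1 ?addr0// => i _; rewrite mul0r.
Qed.

(** Degree n of a power involves only the coefficients of [f] up to degree n, so a polynomial
    truncation may replace the series. *)
Lemma fps_coef_exp_poly (f : fps A) (p : {poly A}) n k :
  (forall j, (j <= n)%N -> fps_coef f j = p`_j) ->
  fps_coef (f ^+ k) n = (p ^+ k)`_n.
Proof.
move=> fp; elim: k => [|k IHk] in n fp *.
  by rewrite !expr0 coef1; case: n {fp}.
rewrite !exprS coefM; apply: eq_bigr => i _.
rewrite fp ?leq_ord// IHk// => j jn; apply: fp.
exact: leq_trans jn (leq_subr _ _).
Qed.

Lemma fps_coef_scaledX_exp (c : A) k n :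
  fps_coef ((fpsC c * fpsX A) ^+ k) n = c ^+ k * (n == k)%:R.
Proof.
rewrite (@fps_coef_exp_poly _ (c *: 'X)) ?exprZn ?coefZ ?coefXn//.
by move=> i _; rewrite fps_coefCM coefZ coefX.
Qed.

(** Substituting c x for x is multiplicative. *)
Lemma fps_coef_exp_scale (c : A) (f g : fps A) k n :
  (forall j, fps_coef g j = c ^+ j * fps_coef f j) ->
  fps_coef (g ^+ k) n = c ^+ n * fps_coef (f ^+ k) n.
Proof.
move=> gf; elim: k n => [|k IHk] n.
  by case: n => [|n] /=; rewrite ?mul1r ?mulr0.
rewrite !exprS /= mulr_sumr; apply: eq_bigr => i _.
by rewrite gf [X in _ * X]IHk mulrACA -exprD subnKC// leq_ord.
Qed.

(** Modulo x^N the factors become polynomials, and the product distributes over the choices of one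
    degree below N in each factor. *)
Lemma fps_coef_prod (I : finType) (f : I -> fps A) N k : (k < N)%N ->
  fps_coef (\prod_i f i) k =
  \sum_(la : {ffun I -> 'I_N} | (\sum_i la i)%N == k)
     \prod_i fps_coef (f i) (la i).
Proof.
move=> kN.
have -> : fps_coef (\prod_i f i) k
    = (\prod_i \sum_(m < N) (fps_coef (f i) m)%:P * 'X^m)`_k.
  move: k kN.
  apply: (big_rec2 (fun (x : fps A) (y : {poly A}) =>
    forall k, (k < N)%N -> fps_coef x k = y`_k)) => [k _|i y x _ IH k kN].
    by rewrite coef1; case: k.
  rewrite coefM /=; apply: eq_bigr => j _.
  rewrite IH ?(leq_ltn_trans (leq_subr _ _) kN)//; congr (_ * _).
  have jN : (j < N)%N by rewrite (leq_ltn_trans (leq_ord j) kN).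
  under eq_bigr do rewrite mul_polyC.
  by rewrite -(poly_def N (fps_coef (f i))) coef_poly jN.
rewrite bigA_distr_bigA coef_sum [RHS]big_mkcond; apply: eq_bigr => la _.
rewrite big_split /= -rmorph_prod coefCM.
rewrite -(big_morph _ (exprD ('X : {poly A})) (expr0 _)).
by rewrite coefXn eq_sym; case: eqP; rewrite ?mulr1 ?mulr0.
Qed.
End Truncation.

(** * The exponential series and its functional equation *)

Section ExponentialOfScalar.
Variable A : comUnitRingType.
Hypothesis fact_unit : forall n, n`!%:R \is a @GRing.unit A.

(** This is exp (a y). It serves twice: over polynomials in x, with y counting parts, and over the
    complex numbers, with y = z and a = 2 pi i. *)
Definition exp_series (a : A) : fps A := FPS (fun k => a ^+ k / k`!%:R).

Lemma exp_series0 : exp_series 0 = 1.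
Proof.
by apply: fpsP => -[|n] /=; rewrite ?expr0 ?divr1// exprS !mul0r.
Qed.

(** The binomial theorem, divided by n!. *)
Lemma exp_seriesD (a b : A) : exp_series (a + b) = exp_series a * exp_series b.
Proof.
apply: fpsP => n /=; rewrite addrC exprDn mulr_suml; apply: eq_bigr => i _.
have bin_div : 'C(n, i)%:R / n`!%:R = i`!%:R^-1 * (n - i)`!%:R^-1 :> A.
  apply: (mulIr (fact_unit n)).
  rewrite divrK// -(bin_fact (leq_ord i)) !natrM mulrCA mulrACA.
  by rewrite !mulVr// !mulr1.
by rewrite -[_ *+ 'C(_, _)]mulr_natr -!mulrA bin_div 2!(mulrCA (b ^+ _)).
Qed.

Lemma exp_series_sum (I : finType) (a : I -> A) :
  exp_series (\sum_i a i) = \prod_i exp_series (a i).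
Proof. exact: (big_morph _ exp_seriesD exp_series0). Qed.

Lemma exp_seriesXz (a : A) (m : int) :
  exp_series a ^ m = exp_series (a *~ m).
Proof.
have nat_case n : exp_series a ^+ n = exp_series (a *+ n).
  elim: n => [|n IHn]; first by rewrite mulr0n exp_series0.
  by rewrite exprS mulrS exp_seriesD IHn.
case: m => n; first by rewrite -exprnP nat_case.
set b := a *+ n.+1.
have bV : exp_series (- b) * exp_series b = 1.
  by rewrite -exp_seriesD addNr exp_series0.
have bU : exp_series b \is a GRing.unit := fps_unitPl bV.
change (exp_series a ^- n.+1 = exp_series (- b)).
by apply: (mulIr bU); rewrite nat_case mulVr ?bV.
Qed.
End ExponentialOfScalar.

(** * Expansion of powers and exponentials over partitions *)

Section PartitionExpansion.
Variable F : fieldType.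
Hypothesis F0 : [pchar F] =i pred0.

Lemma fact_neq0 n : n`!%:R != 0 :> F.
Proof. by rewrite ((pcharf0P F).1 F0) -lt0n fact_gt0. Qed.

(** The left side is the coefficient of x^n y^k in exp (y f), a product of factors exp (y f_j x^j)
    that expands over multiplicities. *)
Lemma fps_coef_divpow (f : fps F) n k : fps_coef f 0 = 0 -> (k <= n)%N ->
  fps_coef (f ^+ k) n / k`!%:R =
  \sum_(la : multiplicities n | is_part la && (part_length la == k))
     \prod_(j < n) (fps_coef f j.+1 ^+ la j / (la j)`!%:R).
Proof.
move=> f0 kn.
(* The truncation of [f] is a finite sum of monomials, so its exponential has finitely many
   factors. *)
pose p : {poly F} := \sum_(j < n) (fps_coef f j.+1) *: 'X^(j.+1).
have fp j : (j <= n)%N -> fps_coef f j = p`_j.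
  rewrite /p coef_sum; case: j => [_|j jn].
    by rewrite f0 big1// => i _; rewrite coefZ coefXn mulr0.
  rewrite (bigD1 (Ordinal jn))//= coefZ coefXn eqxx mulr1 big1 ?addr0// => i.
  by rewrite -val_eqE eq_sym coefZ coefXn eqSS /= => /negPf ->; rewrite mulr0.
have factE m : (m`!%:R)^-1 = (m`!%:R^-1)%:P :> {poly F}.
  by rewrite -polyCV rmorph_nat.
have poly_fact_unit m : m`!%:R \is a @GRing.unit {poly F}.
  by rewrite -polyC_natr rmorph_unit// unitfE fact_neq0.
rewrite (fps_coef_exp_poly _ fp) -coefMC -factE.
rewrite -[LHS]/((fps_coef (exp_series p) k)`_n).
rewrite (exp_series_sum poly_fact_unit) (@fps_coef_prod _ _ _ n.+1) ?ltnS//.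
rewrite coef_sum [LHS]big_mkcond [RHS]big_mkcond; apply: eq_bigr => la _.
rewrite /is_part /part_length; case: eqP; rewrite ?andbF ?andbT// => _.
(* The degree in y has imposed the length k; the degree in x now imposes [is_part]. *)
rewrite /= (eq_bigr (fun j : 'I_n => (fps_coef f j.+1 ^+ la j / (la j)`!%:R)%:P
    * 'X^(j.+1 * la j))).
  rewrite big_split /= -rmorph_prod coefCM.
  rewrite -(big_morph _ (exprD ('X : {poly F})) (expr0 _)).
  by rewrite coefXn eq_sym; case: eqP; rewrite ?mulr1 ?mulr0.
by move=> j _; rewrite exprZn -exprM factE -mul_polyC polyCM mulrAC.
Qed.

Lemma part_length_le n (la : multiplicities n) :
  is_part la -> (part_length la <= n)%N.
Proof. by move=> /eqP {2}<-; apply: leq_sum => j _; rewrite leq_pmull. Qed.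

(* Faa di Bruno's formula: [a k / k!] and [X j / j!] are the coefficients of
   the outer and of the inner series. *)
Lemma faa_di_bruno (a X : nat -> F) (f : fps F) n :
  fps_coef f 0 = 0 ->
  (forall j, (0 < j <= n)%N -> fps_coef f j = X j / j`!%:R) ->
  n`!%:R * (\sum_(k < n.+1) a k * (fps_coef (f ^+ k) n / k`!%:R)) =
  \sum_(la : multiplicities n | is_part la)
    a (part_length la) * phiB _ la * part_prod X la.
Proof.
move=> f0 fX.
(* Partitions are grouped by length; [inord] is faithful since the length is at most n. *)
rewrite (partition_big (fun la => inord (part_length la) : 'I_n.+1) predT)//=.
rewrite mulr_sumr; apply: eq_bigr => k _.
rewrite (fps_coef_divpow f0 (leq_ord k)) !mulr_sumr; apply: eq_big => la.
  case: (boolP (is_part la)) => //= /part_length_le len.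
  by rewrite -val_eqE /= inordK.
move=> /andP[_ /eqP ->]; rewrite mulrCA -mulrA; congr (_ * _).
rewrite /phiB /part_prod -mulrA; congr (_ * _); rewrite -big_split.
apply: eq_bigr => j _ /=; rewrite fX ?ltn_ord//.
by rewrite expr_div_n [RHS]mulrC invfM mulrA mulrAC.
Qed.

Lemma fps_exp_coef0 (f : fps F) : fps_coef (fps_exp f) 0 = 1.
Proof. by rewrite /= big_nat1 expr0 divr1. Qed.

Lemma egf_coef (X : nat -> F) (c : F) n :
  fps_coef (egf X (fpsC c * fpsX F)) n =
  if n == 0%N then 0 else c ^+ n * (X n / n`!%:R).
Proof.
rewrite [LHS]/=; under eq_bigr do rewrite fps_coef_scaledX_exp.
case: n => [|n]; first by rewrite big_geq.
rewrite big_nat_recr//= eqxx mulr1 big_nat big1 => [|k /andP[_ kn]].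
  by rewrite add0r mulrA [X _ * _]mulrC.
by rewrite gtn_eqF// !mulr0 mul0r.
Qed.

Lemma fps_coef_exp_egf (X : nat -> F) (c : F) n :
  fps_coef (fps_exp (egf X (fpsC c * fpsX F))) n = c ^+ n / n`!%:R * bell n X.
Proof.
rewrite /bell mulrA divfK ?fact_neq0// /= mulr_sumr.
apply: eq_bigr => k _; rewrite mulrA; congr (_ / _).
apply: fps_coef_exp_scale => j.
rewrite -{2}[fpsX F]mul1r !egf_coef; case: (j == 0%N); first by rewrite mulr0.
by rewrite expr1n mul1r.
Qed.

Lemma bell_partitions (X : nat -> F) n :
  bell n X =
  \sum_(la : multiplicities n | is_part la) phiB _ la * part_prod X la.
Proof.
rewrite /bell /= big_mkord; under eq_bigr do rewrite -[_ / _]mul1r.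
have -> : fpsX F = fpsC 1 * fpsX F by rewrite mul1r.
rewrite (@faa_di_bruno (fun=> 1) X) ?egf_coef//.
  by apply: eq_bigr => la _; rewrite mul1r.
by case=> // j _; rewrite egf_coef/= expr1n mul1r.
Qed.
End PartitionExpansion.

(** * Composition and formal derivative of power series *)

Lemma fpsCN (A : comNzRingType) (a : A) : fpsC (- a) = - fpsC a.
Proof. by apply: fpsP => -[|n] //=; rewrite oppr0. Qed.

Lemma fpsCX (A : comNzRingType) (a : A) k : fpsC (a ^+ k) = fpsC a ^+ k.
Proof.
elim: k => // k IHk; rewrite !exprS -IHk; apply: fpsP => n.
by rewrite fps_coefCM; case: n => //= n; rewrite mulr0.
Qed.

Section Composition.
Variable A : comNzRingType.

Definition fps_deriv (f : fps A) : fps A :=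
  FPS (fun n => fps_coef f n.+1 *+ n.+1).

(* Meaningful when [h] has zero constant term. *)
Definition fps_comp (a : nat -> A) (h : fps A) : fps A :=
  FPS (fun n => \sum_(k < n.+1) a k * fps_coef (h ^+ k) n).

Lemma fps_coef_exp_small (h : fps A) k n :
  fps_coef h 0 = 0 -> (n < k)%N -> fps_coef (h ^+ k) n = 0.
Proof.
move=> h0; elim: k n => // k IHk n nk; rewrite exprS /= big_ord_recl h0 mul0r.
rewrite add0r big1// => i _; rewrite [X in _ * X]IHk ?mulr0//.
case: n i nk => [[]//|n] i nk; rewrite lift0 subSS.
by rewrite ltnS in nk; apply: leq_ltn_trans nk; apply: leq_subr.
Qed.

(** In [fps_comp] the summation bound varies with the degree; a single finite sum, valid in all
    degrees below N, allows ring identities. *)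
Lemma fps_comp_coef (a : nat -> A) (h : fps A) N n :
  fps_coef h 0 = 0 -> (n < N)%N ->
  fps_coef (fps_comp a h) n = fps_coef (\sum_(k < N) fpsC (a k) * h ^+ k) n.
Proof.
move=> h0 nN; rewrite fps_coef_sum [LHS]/=.
rewrite (big_ord_widen _ (fun k => a k * fps_coef (h ^+ k) n) nN).
rewrite [LHS]big_mkcond; apply: eq_bigr => k _.
rewrite fps_coefCM; case: ltnP => // nk.
by rewrite fps_coef_exp_small ?mulr0.
Qed.

Lemma fps_comp_mul_coef (a : nat -> A) (h u : fps A) n :
  fps_coef h 0 = 0 ->
  fps_coef (fps_comp a h * u) n =
  fps_coef (\sum_(k < n.+1) fpsC (a k) * h ^+ k * u) n.
Proof.
move=> h0; rewrite -mulr_suml [LHS]/= [RHS]/=; apply: eq_bigr => i _.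
by rewrite -(fps_comp_coef a h0)// ltnS leq_ord.
Qed.

(** Truncation at degree n + 1 reduces this to the product rule for polynomials. *)
Lemma fps_derivM (f g : fps A) :
  fps_deriv (f * g) = fps_deriv f * g + f * fps_deriv g.
Proof.
apply: fpsP => n; rewrite -[LHS]/(fps_coef (fps_mul f g) n.+1 *+ n.+1).
rewrite (@fps_mul_poly _ f g n.+2)//.
rewrite -coef_deriv derivM coefD !coefM.
have trunc (h : fps A) i : (i < n.+2)%N ->
    (\poly_(j < n.+2) fps_coef h j)`_i = fps_coef h i.
  by move=> ilt; rewrite coef_poly ilt.
congr (_ + _); apply: eq_bigr => i _.
  by rewrite coef_deriv !trunc// ltnS// (leq_trans (leq_subr _ _)).
rewrite coef_deriv !trunc// ltnS// ?ltnS ?leq_subr//.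
exact/leqW/leq_ord.
Qed.

Lemma fps_derivXn (f : fps A) n :
  fps_deriv (f ^+ n.+1) = f ^+ n * fps_deriv f *+ n.+1.
Proof.
elim: n => [|n IHn]; first by rewrite expr1 expr0 mul1r.
rewrite exprS fps_derivM IHn mulrnAr mulrA -exprS mulrC.
by rewrite [in RHS]mulrS.
Qed.

Lemma fps_deriv_comp (a : nat -> A) (h : fps A) : fps_coef h 0 = 0 ->
  fps_deriv (fps_comp a h) =
  fps_comp (fun k => a k.+1 *+ k.+1) h * fps_deriv h.
Proof.
move=> h0; apply: fpsP => n; rewrite fps_comp_mul_coef// fps_coef_sum.
(* The term k = 0 is constant and drops out in degree n + 1, which shifts the index by one. *)
rewrite [LHS]/= big_ord_recl expr0 [fps_coef 1 _]/= mulr0 add0r -sumrMnl.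
apply: eq_bigr => k _; rewrite -mulrA fps_coefCM lift0 -mulrnAr.
change (a k.+1 * fps_coef (fps_deriv (h ^+ k.+1)) n =
  a k.+1 *+ k.+1 * fps_coef (h ^+ k * fps_deriv h) n).
rewrite fps_derivXn [RHS]mulrnAl -[RHS]mulrnAr; congr (_ * _).
exact: fps_coefMn.
Qed.

(** The partial sums telescope up to (-h)^(n + 1), which has no coefficient in degree n. *)
Lemma fps_comp_geometric (h : fps A) : fps_coef h 0 = 0 ->
  fps_comp (fun k => (-1) ^+ k) h * (1 + h) = 1.
Proof.
move=> h0; apply: fpsP => n; rewrite fps_comp_mul_coef// -mulr_suml.
rewrite (eq_bigr (fun k : 'I_n.+1 => (- h) ^+ k)); last first.
  by move=> k _; rewrite fpsCX exprNn fpsCN.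
have -> : 1 + h = - (- h - 1) by rewrite opprB opprK addrC.
rewrite mulrN mulrC -subrX1 opprB.
change (fps_coef 1 n - fps_coef ((- h) ^+ n.+1) n = fps_coef 1 n).
by rewrite fps_coef_exp_small ?subr0//= h0 oppr0.
Qed.
End Composition.

(** * The logarithm and the inversion of the Bell polynomials *)

Section Logarithm.
Variable F : fieldType.
Hypothesis F0 : [pchar F] =i pred0.

Lemma natS_neq0 n : n.+1%:R != 0 :> F.
Proof. by rewrite ((pcharf0P F).1 F0). Qed.

Lemma fps_deriv_inj (f g : fps F) :
  fps_coef f 0 = fps_coef g 0 -> fps_deriv f = fps_deriv g -> f = g.
Proof.
move=> fg0 fg; apply: fpsP => -[//|n].
have := congr1 (fun h => fps_coef h n) fg; rewrite /=.
rewrite -[LHS]mulr_natr -[RHS]mulr_natr; exact/mulIf/natS_neq0.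
Qed.

Lemma fps_exp_comp (f : fps F) :
  fps_exp f = fps_comp (fun k => k`!%:R^-1) f.
Proof.
apply: fpsP => n; rewrite /= big_mkord; apply: eq_bigr => k _; exact: mulrC.
Qed.

Lemma fps_deriv_exp (f : fps F) : fps_coef f 0 = 0 ->
  fps_deriv (fps_exp f) = fps_exp f * fps_deriv f.
Proof.
move=> f0; rewrite fps_exp_comp fps_deriv_comp//; congr (fps_comp _ _ * _).
apply/funext => k; rewrite factS natrM invfM -[LHS]mulr_natr mulrAC.
by rewrite mulVf ?mul1r// natS_neq0.
Qed.

Definition fps_log1p (h : fps F) : fps F :=
  fps_comp (fun k => (-1) ^+ k.-1 / k%:R) h.

(** Both sides have zero constant term; with exp f = 1 + h, the left side has derivative (1 + h)^-1
    h' = f'. *)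
Lemma fps_log1pK (f : fps F) : fps_coef f 0 = 0 ->
  fps_log1p (fps_exp f - 1) = f.
Proof.
move=> f0; set h := fps_exp f - 1.
have h0 : fps_coef h 0 = 0.
  change (fps_coef (fps_exp f) 0 - 1 = 0).
  by rewrite fps_exp_coef0 subrr.
have dh : fps_deriv h = fps_exp f * fps_deriv f.
  rewrite -fps_deriv_exp//; apply: fpsP => n /=.
  by rewrite subr0.
apply: fps_deriv_inj.
  (* The Taylor coefficient for k = 0 is 1 / 0, which is 0 by convention. *)
  by rewrite f0 /= big_ord1 invr0 mulr0 mul0r.
rewrite fps_deriv_comp// dh mulrA.
have -> : (fun k => (-1) ^+ k.+1.-1 / k.+1%:R *+ k.+1) =
    (fun k => (-1) ^+ k) :> (nat -> F).
  by apply/funext => k; rewrite -[LHS]mulr_natr divfK// natS_neq0.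
have -> : fps_exp f = 1 + h by rewrite addrC subrK.
by rewrite fps_comp_geometric// mul1r.
Qed.

(* [mu] collects the Taylor coefficients [(-1)^(l - 1) (l - 1)!] of
   [log (1 + h)]. *)
Lemma bell_inversion (X M : nat -> F) n : (0 < n)%N ->
  (forall j, (0 < j <= n)%N -> M j = bell j X) ->
  X n = \sum_(la : multiplicities n | is_part la)
          mu _ la * phiB _ la * part_prod M la.
Proof.
move=> n0 MX; set f := egf X (fpsX F).
have fE j : fps_coef f j = if j == 0%N then 0 else X j / j`!%:R.
  have -> : f = egf X (fpsC 1 * fpsX F) by rewrite mul1r.
  by rewrite egf_coef expr1n mul1r.
have f0 : fps_coef f 0 = 0 by rewrite fE.
have -> : X n = n`!%:R * fps_coef f n.
  by rewrite fE gtn_eqF// mulrC divfK// fact_neq0.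
rewrite -{1}(fps_log1pK f0).
have h0 : fps_coef (fps_exp f - 1) 0 = 0.
  change (fps_coef (fps_exp f) 0 - 1 = 0).
  by rewrite fps_exp_coef0 subrr.
rewrite -(@faa_di_bruno _ F0
  (fun l => (-1) ^+ l.-1 * (l.-1)`!%:R) M _ _ h0).
  (* At index 0 both terms vanish, as n > 0; at index k + 1 use 1 / (k + 1) = k! / (k + 1)!. *)
  congr (_ * _); rewrite [LHS]/=; apply: eq_bigr => -[[|k] kn] _ /=.
    by rewrite gtn_eqF// !mul0r !mulr0.
  rewrite factS natrM -!mulrA; congr (_ * _).
  by rewrite invfM [RHS]mulrC -!mulrA mulVf ?fact_neq0// mulr1 mulrC.
(* Subtracting 1 from exp f affects degree 0 only, so the positive degrees up to n still carry M_j /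
   j!. *)
move=> [//|j] jn; rewrite MX// /bell mulrAC divff ?fact_neq0// mul1r.
by rewrite [LHS]/= subr0.
Qed.
End Logarithm.

(** * The moments as Taylor coefficients of G_S in z *)

Section Moments.
Variable R : realType.

Lemma complex_fact_unit n : n`!%:R \is a @GRing.unit R[i]%C.
Proof. by rewrite unitfE Num.Theory.pnatr_eq0 -lt0n fact_gt0. Qed.

(** The q-series embed in their fraction field, and the constant term of the series n detects
    whether n is 0. *)
Lemma pchar_qfield : [pchar (qfield R)] =i pred0.
Proof.
apply/pcharf0P => n; rewrite -(rmorph_nat (@tofrac (fps R[i]%C))) tofrac_eq0.
apply/idP/eqP => [/eqP/(congr1 (fun f => fps_coef f 0%N))|->//].
by rewrite fps_coefMn => /eqP; rewrite Num.Theory.pnatr_eq0 => /eqP.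
Qed.

Lemma fps_exp_two_pi_i_z : fps_exp (two_pi_i_z R) = exp_series (two_pi_i R).
Proof.
apply: fpsP => n /=; rewrite big_mkord big_ord_recr/=.
rewrite fps_coef_scaledX_exp eqxx mulr1 big1 ?add0r// => k _.
by rewrite fps_coef_scaledX_exp gtn_eqF// mulr0 mul0r.
Qed.

Definition qconst (c : R[i]%C) : qfield R := of_qseries (fpsC c).

Lemma qconst_exp_fact (c : R[i]%C) r :
  qconst (c ^+ r / r`!%:R) = qconst c ^+ r / r`!%:R.
Proof.
have r_neq0 := fact_neq0 pchar_qfield r.
apply: (mulIf r_neq0); rewrite divfK//.
rewrite /qconst /of_qseries -rmorphXn.
rewrite -(rmorph_nat (@tofrac (fps R[i]%C))) -rmorphM.
congr (tofrac _); rewrite mulr_natr -fpsCX; apply: fpsP => n.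
rewrite fps_coefMn /=; case: eqP => _; last by rewrite mul0rn.
by rewrite -[LHS]mulr_natr divrK// complex_fact_unit.
Qed.

Lemma two_pi_i_zE :
  fps_map qconst (two_pi_i_z R) = fpsC (qconst (two_pi_i R)) * fpsX (qfield R).
Proof.
apply: fpsP => n; rewrite fps_coefCM.
rewrite -[LHS]/(qconst (fps_coef (two_pi_i_z R) n)) fps_coefCM.
rewrite [fps_coef (fpsX _) _]/= [fps_coef (fpsX (qfield R)) _]/=.
case: (n == 1%N); first by rewrite !mulr1.
rewrite !mulr0 /qconst /of_qseries (_ : fpsC 0 = 0) ?tofrac0//.
by apply: fpsP => -[].
Qed.

Lemma qconst_two_pi_i_neq0 : qconst (two_pi_i R) != 0.
Proof.
rewrite tofrac_eq0; apply/eqP => /(congr1 (fun f => fps_coef f 0%N)) /= /eqP.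
apply/negP; rewrite eq_complex /= eqxx /= mulf_neq0 ?Num.Theory.pnatr_eq0//.
by rewrite Order.POrderTheory.gt_eqF// pi_gt0.
Qed.

Section Statistic.
Variables (T : choiceType) (wt : T -> nat) (s : T -> int).
Hypothesis fin_wt : forall n : nat, finite_set [set x | wt x = n].

(** Finitely many objects of weight n take finitely many values of [s]; any other m has no object
    and contributes 0. *)
Lemma fsum_nb_objects (V : nmodType) (F : int -> V) n :
  (forall m, nb_objects wt s m n = 0%N -> F m = 0) ->
  \sum_(m \in [set: int]) F m =
  \sum_(m <- fset_set (s @` [set x | wt x = n])) F m.
Proof.
move=> F0; rewrite -fsbig_finite; last exact/finite_image.
apply/esym/fsbig_widen => // m [_ /= nm]; apply: F0.
rewrite /nb_objects (_ : [set x | _] = set0) ?fset_set0 ?cardfs0//.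
by apply/seteqP; split=> x //= -[xn xm]; apply: nm; exists x.
Qed.

(** Since zeta^m = exp (2 pi i m z), its coefficient of z^r is (2 pi i)^r m^r / r!, and only m^r
    stays inside the sum over m. *)
Lemma GS_z_coef r : fps_coef (GS_z wt s R) r =
  qconst (two_pi_i R) ^+ r / r`!%:R * of_qseries (power_sum_series wt s R r).
Proof.
rewrite -qconst_exp_fact /qconst /of_qseries -rmorphM; congr (tofrac _).
apply: fpsP => n; rewrite fps_coefCM /= fps_exp_two_pi_i_z.
rewrite (@fsum_nb_objects _ _ n) => [|m ->]; last by rewrite mul0r.
rewrite (@fsum_nb_objects _ _ n) => [|m ->]; last by rewrite mulr0.
rewrite fps_coef_sum mulr_sumr; apply: eq_bigr => m _.
rewrite (exp_seriesXz complex_fact_unit) mulr_natl fps_coefMn /=.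
by rewrite -mulrzr exprMn mulr_natr mulrAC mulrnAr.
Qed.
End Statistic.
End Moments.

Theorem proposition3p1 (R : realType) (T : choiceType)
  (wt : T -> nat) (s : T -> int)
  (fin_wt : forall n : nat, finite_set [set x | wt x = n])
  (GS1_neq0 : GS1 wt s R != 0)
  (g : nat -> qfield R)
  (g_def : GS_z wt s R =
     fpsC (of_qseries (GS1 wt s R)) *
     fps_exp (egf g (fps_map (fun c => of_qseries (fpsC c)) (two_pi_i_z R)))) :
  (forall r : nat, (0 < r)%N ->
     moment wt s R r = bell r g /\
     bell r g =
       \sum_(la : multiplicities r | is_part la) phiB _ la * part_prod g la) /\
  (forall k : nat, (0 < k)%N ->
     g k = \sum_(la : multiplicities k | is_part la)
             mu _ la * phiB _ la * part_prod (moment wt s R) la).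
Proof.
have momE r : moment wt s R r = bell r g.
  (* This factor occurs on both sides of [g_def] in degree r of z and is cancelled. *)
  have c_neq0 : qconst (two_pi_i R) ^+ r / r`!%:R != 0.
    apply: mulf_neq0; first exact/expf_neq0/qconst_two_pi_i_neq0.
    exact/invr_neq0/fact_neq0/pchar_qfield.
  have G_neq0 : of_qseries (GS1 wt s R) != 0 by rewrite tofrac_eq0.
  have := congr1 (fun f => fps_coef f r) g_def.
  rewrite (GS_z_coef R s fin_wt) fps_coefCM two_pi_i_zE.
  rewrite (fps_coef_exp_egf (pchar_qfield R)) [RHS]mulrCA /moment.
  by move=> /(mulfI c_neq0) ->; rewrite mulKf.
split=> [r r_gt0|k k_gt0].
  by split; [exact: momE|exact: (bell_partitions (pchar_qfield R))].
by apply: (bell_inversion (pchar_qfield R)) => // j _; exact: momE.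
Qed.
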